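(* Let $\mathcal{A}$ be the infinitesimal generator of a birth--death process on $\mathbb{N}_0$ with rates $\{\lambda_n,\mu_n\}$ ($\lambda_n>0$ for $n\ge 0$, $\mu_n>0$ for $n\ge1$, $\mu_0\ge0$). Let $\hat\mu_0\ge 0$ and consider the LU factorization $\mathcal{A}=\widetilde{\mathcal{A}}_L\widetilde{\mathcal{A}}_U$, where $\widetilde{\mathcal{A}}_L$ is lower bidiagonal with diagonal $(\tilde s_n)_{n\ge0}$ and subdiagonal $(\tilde r_n)_{n\ge1}$, and $\widetilde{\mathcal{A}}_U$ is upper bidiagonal with diagonal $(\tilde y_n)_{n\ge0}$ and superdiagonal $(\tilde x_n)_{n\ge0}$, the coefficients being given by the explicit formulas (depending on $\hat\mu_0$) recorded in the context. Let $\widehat{\mathcal{A}}=\widetilde{\mathcal{A}}_U\widetilde{\mathcal{A}}_L$ be the Darboux transform of $\mathcal{A}$. Then $\widehat{\mathcal{A}}$ is the infinitesimal generator of a birth--death process on $\mathbb{N}_0$ with absorption rate $\hat\mu_0$ and with birth and death rates $$\hat\lambda_n=\lambda_n\frac{\tilde s_{n+1}}{\tilde s_n},\qquad \hat\mu_{n+1}=\frac{\lambda_{n+1}\mu_{n+1}}{\lambda_n}\cdot\frac{\tilde q_{n+1}}{\tilde q_n}\cdot\frac{\tilde s_n}{\tilde s_{n+1}},\quad n\ge0,\qquad \text{where }\ \tilde q_n=-\frac{Q_{n+1}(0)}{Q_n(0)},$$ if and only if the absorption rate $\hat\mu_0$ satisfies $$0\le\hat\mu_0\le(\lambda_0+\mu_0)\,\frac{S}{S-1},\qquad\text{where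 } S=\sum_{k=0}^\infty\pi_kQ_k^2(0)>1$$ (with $S/(S-1)=1$ when $S=\infty$).
   Context: Infinitesimal generator of a birth--death process on $\mathbb{N}_0$ with rates $\{\lambda_n,\mu_n\}$: the semi-infinite tridiagonal matrix $\mathcal{A}$ with entries $\mathcal{A}_{n,n+1}=\lambda_n>0$ ($n\ge0$), $\mathcal{A}_{n,n-1}=\mu_n>0$ ($n\ge1$), $\mathcal{A}_{n,n}=-(\lambda_n+\mu_n)$ ($n\ge0$), with $\mu_0\ge0$, and all other entries $0$. The number $\mu_0$ is the absorption rate (from state $0$ to an absorbing state $-1$). Thus a tridiagonal matrix $\widehat{\mathcal{A}}$ is the generator of a birth--death process with absorption rate $\hat\mu_0$ iff its off-diagonal entries (next to the diagonal) are all positive, $\hat\mu_0\ge0$, its first row sums to $-\hat\mu_0$ and all its other rows sum to $0$. Potential coefficients: $\pi_0=1$, $\pi_n=\dfrac{\lambda_0\cdots\lambda_{n-1}}{\mu_1\cdots\mu_n}$ for $n\ge1$. Polynomials: $Q_{-1}(x)=0$, $Q_0(x)=1$, $-xQ_n(x)=\lambda_nQ_{n+1}(x)-(\lambda_n+\mu_n)Q_n(x)+\mu_nQ_{n-1}(x)$, $n\ge0$. In particular $Q_n(0)=1+\mu_0\sum_{k=0}^{n-1}\frac1{\lambda_k\pi_k}$. Coefficients of the LU factorization: put $c=\dfrac{\hat\mu_0}{\lambda_0+\mu_0}$ and $D_n=c+(1-c)\sum_{k=0}^n\pi_kQ_k^2(0)$ for $n\ge0$ (so $D_0=1$). Then $$\tilde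 s_n=\frac{D_n}{\pi_nQ_n(0)},\quad \tilde x_n=\frac{\lambda_n\pi_nQ_n(0)}{D_n},\quad \tilde y_n=-\frac{\lambda_n\pi_nQ_{n+1}(0)}{D_n}\quad(n\ge0),\qquad \tilde r_n=-\frac{D_{n-1}}{\pi_nQ_n(0)}\quad(n\ge1);$$ in particular $\tilde s_0=1$, $\tilde x_0=\lambda_0$, $\tilde y_0=-(\lambda_0+\mu_0)$. It is a standing assumption that the factorization makes sense, i.e. $\tilde s_n\neq0$ (equivalently $D_n\ne0$) for all $n$. *)

(* Defs.v *)
From HB Require Import structures.
From mathcomp Require Import all_boot all_order all_algebra.
From mathcomp Require Import all_classical all_reals all_analysis.

Set Implicit Arguments.
Unset Strict Implicit.
Unset Printing Implicit Defensive.

Import Order.TTheory GRing.Theory Num.Theory.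
Import numFieldNormedType.Exports.

Local Open Scope ring_scope.

Section SemiInfiniteMatrices.
Context {R : realType}.
Implicit Types (A B : nat -> nat -> R) (lam mu d e : nat -> R).

(* For the banded matrices considered here every series is a finite sum. *)
Definition smul A B : nat -> nat -> R :=
  fun i j => limn (series (fun k => A i k * B k j)).

(* The subdiagonal entry in row n is [e n]; [e 0] is not used. *)
Definition lower_bidiag d e : nat -> nat -> R := fun i j =>
  if j == i then d i else if i == j.+1 then e i else 0.

Definition upper_bidiag d e : nat -> nat -> R := fun i j =>
  if j == i then d i else if j == i.+1 then e i else 0.

Definition bd_matrix lam mu : nat -> nat -> R := fun i j =>
  if j == i then - (lam i + mu i)
  else if j == i.+1 then lam i
  else if i == j.+1 then mu i
  else 0.

(* [mu 0] is the absorption rate from state 0, which may vanish. *)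
Definition bd_generator A lam mu : Prop :=
  [/\ forall n, 0 < lam n, forall n, 0 < mu n.+1, 0 <= mu 0%N
    & A =2 bd_matrix lam mu].

End SemiInfiniteMatrices.

Section BirthDeath.
Context {R : realType}.
Variables lam mu : nat -> R.

Definition bd_pi (n : nat) : R :=
  (\prod_(0 <= k < n) lam k) / (\prod_(0 <= k < n) mu k.+1).

(* The pair (Q_{n-1}, Q_n), with Q_{-1} = 0 and Q_0 = 1. *)
Fixpoint bd_Qpair (n : nat) : {poly R} * {poly R} :=
  if n is m.+1 then
    let: (p, q) := bd_Qpair m in
    (q, (lam m)^-1 *: (((lam m + mu m)%:P - 'X) * q - mu m *: p))
  else (0, 1).

Definition bd_Q (n : nat) : {poly R} := (bd_Qpair n).2.

Definition bd_S : \bar R :=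
  (\sum_(0 <= k <oo) (bd_pi k * (bd_Q k).[0] ^+ 2)%:E)%E.

Definition lu_q (n : nat) : R := - ((bd_Q n.+1).[0] / (bd_Q n).[0]).

Variable hmu0 : R.

Definition lu_c : R := hmu0 / (lam 0%N + mu 0%N).

Definition lu_D (n : nat) : R :=
  lu_c + (1 - lu_c) * \sum_(0 <= k < n.+1) bd_pi k * (bd_Q k).[0] ^+ 2.

Definition lu_s (n : nat) : R := lu_D n / (bd_pi n * (bd_Q n).[0]).

Definition lu_x (n : nat) : R := lam n * bd_pi n * (bd_Q n).[0] / lu_D n.

Definition lu_y (n : nat) : R :=
  - (lam n * bd_pi n * (bd_Q n.+1).[0] / lu_D n).

(* Only used for 0 < n, since [n.-1] is truncated. *)
Definition lu_r (n : nat) : R := - (lu_D n.-1 / (bd_pi n * (bd_Q n).[0])).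

Definition lu_L : nat -> nat -> R := lower_bidiag lu_s lu_r.
Definition lu_U : nat -> nat -> R := upper_bidiag lu_y lu_x.

Definition darboux : nat -> nat -> R := smul lu_U lu_L.

Definition darboux_lam (n : nat) : R := lam n * (lu_s n.+1 / lu_s n).

Definition darboux_mu (n : nat) : R :=
  if n is m.+1 then
    lam m.+1 * mu m.+1 / lam m * (lu_q m.+1 / lu_q m) * (lu_s m / lu_s m.+1)
  else hmu0.

End BirthDeath.

(* S / (S - 1), extended by its limit 1 at S = +oo; S = -oo does not occur
   for series of nonnegative terms. *)
Definition ratio_pred {R : realType} (S : \bar R) : R :=
  if S is (r%:E)%E then r / (r - 1) else 1.

(* Main.v *)
Require Import Defs.
From HB Require Import structures.
From mathcomp Require Import all_boot all_order all_algebra.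
From mathcomp Require Import all_classical all_reals all_analysis.
From mathcomp Require Import ring lra zify.

Set Implicit Arguments.
Unset Strict Implicit.
Unset Printing Implicit Defensive.

Import Order.TTheory GRing.Theory Num.Theory.
Import numFieldNormedType.Exports.

Local Open Scope ring_scope.

(** Write q_n for Q_n(0), w_n = pi_n q_n^2 and T_n = w_0 + ... + w_n, so that
    D_n = c + (1 - c) T_n with c = hmu0 / (lam_0 + mu_0).

    The recurrence at x = 0 reads
    lam_n (q_(n+1) - q_n) = mu_n (q_n - q_(n-1)), so q is positive and
    nondecreasing [bd_Q0_gt0_le]. With pi_(n+1) mu_(n+1) = pi_n lam_n, this
    recurrence is exactly what makes the diagonal of L U equal to that of A;
    the factors D_n cancel everywhere [LU_factorization].

    The Darboux transform U L always equals the tridiagonal matrix built from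
    the announced rates, whatever their signs [darboux_bd_matrix]. Its row
    sums rest on D_(n+1) - D_n = (1 - c) w_(n+1): both hat lam_n and hat mu_n
    differ from a quantity independent of hmu0 by
    (1 - c) lam_n pi_n q_n q_(n+1) / D_n, with opposite signs. The only
    question is therefore whether the rates are positive. As they have the
    signs of D_(n+1) / D_n and D_n / D_(n+1) and D_0 = 1, this means that
    D_n > 0 for all n [darboux_generatorE].

    Finally, D_n > 0 for all n iff c <= S / (S - 1)
    [affine_partial_sums_gt0]. If c <= 1 both sides hold because T_n >= 1.
    If c > 1, the left side says that T_n < c / (c - 1) for all n; since T is
    strictly increasing with limit S, this is S <= c / (c - 1), and
    t |-> t / (t - 1) is a decreasing involution of ]1, +oo[. *)

(** * Products of bidiagonal matrices *)

Section BandedProducts.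
Context {R : realType}.
Implicit Types (B : nat -> nat -> R) (d e s r x y : nat -> R).

Lemma limn_series_finite (f : nat -> R) N :
  (forall k, (N <= k)%N -> f k = 0) ->
  limn (series f) = \sum_(0 <= k < N) f k.
Proof.
move=> f_eq0; apply/cvg_lim; first exact: Rhausdorff.
apply: cvg_near_cst; exists N => // n /= leNn.
rewrite /series /= (big_cat_nat _ leNn) //= -[RHS]addr0; congr (_ + _).
by rewrite big_nat_cond big1 // => k /andP[/andP[/f_eq0]].
Qed.

Lemma smul_lower_bidiag d e B i j :
  smul (lower_bidiag d e) B i j =
  d i * B i j + (if i is m.+1 then e i * B m j else 0).
Proof.
rewrite /smul (@limn_series_finite _ i.+1) => [|k leik]; last first.
  by rewrite /lower_bidiag !ifF ?mul0r //; apply/negbTE/eqP; lia.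
case: i => [|m]; first by rewrite big_nat1 /lower_bidiag eqxx addr0.
rewrite !big_nat_recr //= big_nat_cond big1 => [|k /andP[/andP[_ ltkm] _]].
  rewrite /lower_bidiag !eqxx ifF ?add0r 1?addrC //.
  by apply/negbTE/eqP; lia.
by rewrite /lower_bidiag !ifF ?mul0r //; apply/negbTE/eqP; lia.
Qed.

Lemma smul_upper_bidiag d e B i j :
  smul (upper_bidiag d e) B i j = d i * B i j + e i * B i.+1 j.
Proof.
rewrite /smul (@limn_series_finite _ i.+2) => [|k leik]; last first.
  by rewrite /upper_bidiag !ifF ?mul0r //; apply/negbTE/eqP; lia.
rewrite !big_nat_recr //= big_nat_cond big1 => [|k /andP[/andP[_ ltkm] _]].
  rewrite /upper_bidiag !eqxx ifF ?add0r //.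
  by apply/negbTE/eqP; lia.
by rewrite /upper_bidiag !ifF ?mul0r //; apply/negbTE/eqP; lia.
Qed.

Lemma smul_lower_upper s r y x i j :
  smul (lower_bidiag s r) (upper_bidiag y x) i j =
  if j == i then s i * y i + (if i is m.+1 then r i * x m else 0)
  else if j == i.+1 then s i * x i
  else if i == j.+1 then r i * y j
  else 0.
Proof.
rewrite smul_lower_bidiag /upper_bidiag.
case: i => [|m]; first by rewrite addr0; case: j => [|[|j]] /=; rewrite ?addr0 ?mulr0.
rewrite eqSS [m == j]eq_sym.
have [->|_] := eqVneq j m.+1; first by rewrite ifF //; apply/negbTE/eqP; lia.
have [->|_] := eqVneq j m.+2.
  by rewrite ifF ?mulr0 ?addr0 //; apply/negbTE/eqP; lia.
by have [->|_] := eqVneq j m; rewrite ?mulr0 ?addr0 ?add0r.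
Qed.

Lemma smul_upper_lower s r y x i j :
  smul (upper_bidiag y x) (lower_bidiag s r) i j =
  if j == i then y i * s i + x i * r i.+1
  else if j == i.+1 then x i * s i.+1
  else if i == j.+1 then y i * r i
  else 0.
Proof.
rewrite smul_upper_bidiag /lower_bidiag.
rewrite eqSS [i == j]eq_sym.
have [->|_] := eqVneq j i; first by rewrite ifF //; apply/negbTE/eqP; lia.
have [->|_] := eqVneq j i.+1.
  by rewrite ifF ?mulr0 ?add0r //; apply/negbTE/eqP; lia.
by case: ifP => _; rewrite ?mulr0 ?addr0.
Qed.

End BandedProducts.

(** * Partial sums of a positive series *)

Section PositiveSeries.
Context {R : realType}.
Variable w : nat -> R.
Hypothesis w_gt0 : forall k, 0 < w k.

Let S : \bar R := (\sum_(0 <= k <oo) (w k)%:E)%E.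

Lemma partial_sum_lt n : ((\sum_(0 <= k < n) w k)%:E < S)%E.
Proof.
apply: (@lt_le_trans _ _ (\sum_(0 <= k < n.+1) w k)%:E%E).
  by rewrite lte_fin big_nat_recr //= ltrDl.
rewrite -sumEFin; apply: nneseries_lim_ge => k _ _.
by rewrite lee_fin ltW.
Qed.

(** The inequality is strict on the right only, because a strictly increasing
    sequence never reaches its limit: this is why the endpoint
    hmu0 = (lam_0 + mu_0) S / (S - 1) is admissible. *)
Lemma series_le_iff M :
  (S <= M%:E)%E <-> forall n, \sum_(0 <= k < n.+1) w k < M.
Proof.
split=> [leSM n|ltM].
  by rewrite -lte_fin; apply: lt_le_trans leSM; exact: partial_sum_lt.
apply: lime_le; first by apply: is_cvg_nneseries => k _ _; rewrite lee_fin ltW.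
apply: nearW => n; rewrite sumEFin lee_fin.
apply/ltW/(le_lt_trans _ (ltM n)).
by rewrite big_nat_recr //= lerDl ltW.
Qed.

Hypothesis w0 : w 0%N = 1.

Lemma series_gt1 : (1 < S)%E.
Proof. by have := partial_sum_lt 1; rewrite big_nat1 w0. Qed.

(** For c <= 1 the combination is 1 + (1 - c) (T_n - 1) >= 1, and the right
    side holds since S / (S - 1) >= 1. For c > 1 positivity is the upper bound
    c / (c - 1) on all partial sums, hence on S; if S = +oo this is
    impossible. *)
Lemma affine_partial_sums_gt0 c :
  (forall n, 0 < c + (1 - c) * \sum_(0 <= k < n.+1) w k) <->
  c <= ratio_pred S.
Proof.
have T_ge1 n : 1 <= \sum_(0 <= k < n.+1) w k.
  rewrite big_nat_recl //= w0 lerDl.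
  by apply: sumr_ge0 => k _; rewrite ltW.
have [c_le1|c_gt1] := leP c 1.
  split=> [_|_ n]; last by have := T_ge1 n; nra.
  apply: (le_trans c_le1); rewrite /ratio_pred.
  case: S series_gt1 => [r||//]; rewrite ?lte_fin // => r_gt1.
  by rewrite ler_pdivlMr; lra.
have gt0E n : (0 < c + (1 - c) * \sum_(0 <= k < n.+1) w k) =
              (\sum_(0 <= k < n.+1) w k < c / (c - 1)).
  by rewrite ltr_pdivlMr ?subr_gt0 // -[RHS]subr_gt0; congr (_ < _); ring.
transitivity ((S <= (c / (c - 1))%:E)%E : Prop).
  by rewrite series_le_iff; split=> h n; [rewrite -gt0E|rewrite gt0E].
rewrite /ratio_pred.
case: S series_gt1 => [r||//]; last by move=> _; rewrite leye_eq; split=> [/eqP|] //; lra.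
rewrite !lee_fin lte_fin => r_gt1.
rewrite ler_pdivlMr ?subr_gt0 // [c <= _]ler_pdivlMr ?subr_gt0 //.
by split; lra.
Qed.

End PositiveSeries.

(** * The Darboux transform of a birth-death generator *)

Section DarbouxTransform.
Context {R : realType}.
Variables lam mu : nat -> R.
Hypothesis lam_gt0 : forall n, 0 < lam n.
Hypothesis mu_gt0 : forall n, 0 < mu n.+1.
Hypothesis mu0_ge0 : 0 <= mu 0%N.

Local Notation pi_ := (bd_pi lam mu).
Local Notation Q0 n := (bd_Q lam mu n).[0].

Lemma bd_pi0 : pi_ 0%N = 1.
Proof. by rewrite /bd_pi !big_nil divr1. Qed.

Lemma bd_pi_gt0 n : 0 < pi_ n.
Proof. by rewrite divr_gt0 // prodr_gt0. Qed.

Lemma bd_piS n : pi_ n.+1 = pi_ n * lam n / mu n.+1.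
Proof. by rewrite /bd_pi !big_nat_recr //= invfM; ring. Qed.

Lemma bd_Qpair1S n : (bd_Qpair lam mu n.+1).1 = bd_Q lam mu n.
Proof. by rewrite /bd_Q /=; case: (bd_Qpair lam mu n). Qed.

Lemma bd_QS n :
  bd_Q lam mu n.+1 = (lam n)^-1 *:
    (((lam n + mu n)%:P - 'X) * bd_Q lam mu n - mu n *: (bd_Qpair lam mu n).1).
Proof. by rewrite /bd_Q /=; case: (bd_Qpair lam mu n). Qed.

Lemma bd_Q0_0 : Q0 0%N = 1.
Proof. by rewrite hornerE. Qed.

Lemma bd_Q0_1 : lam 0%N * Q0 1%N = lam 0%N + mu 0%N.
Proof.
by rewrite bd_QS hornerZ mulVKf ?gt_eqF // !hornerE; ring.
Qed.

Lemma bd_Q0_SS n :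
  lam n.+1 * Q0 n.+2 = (lam n.+1 + mu n.+1) * Q0 n.+1 - mu n.+1 * Q0 n.
Proof.
by rewrite bd_QS bd_Qpair1S hornerZ mulVKf ?gt_eqF // !hornerE; ring.
Qed.

(** Positivity alone is not inductive; monotonicity is added because the
    increments satisfy lam_n (q_(n+1) - q_n) = mu_n (q_n - q_(n-1)). *)
Lemma bd_Q0_gt0_le n : 0 < Q0 n <= Q0 n.+1.
Proof.
elim: n => [|n /andP[q_gt0 q_le]].
  rewrite bd_Q0_0 ltr01 -(ler_pM2l (lam_gt0 0%N)) bd_Q0_1.
  by rewrite mulr1 lerDl.
rewrite (lt_le_trans q_gt0 q_le) -(ler_pM2l (lam_gt0 n.+1)) bd_Q0_SS.
by have := mu_gt0 n; nra.
Qed.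

Lemma bd_Q0_gt0 n : 0 < Q0 n.
Proof. by case/andP: (bd_Q0_gt0_le n). Qed.

Variable hmu0 : R.
Local Notation c := (lu_c lam mu hmu0).
Local Notation D := (lu_D lam mu hmu0).
Local Notation s := (lu_s lam mu hmu0).

Lemma lu_D0 : D 0%N = 1.
Proof. by rewrite /lu_D big_nat1 bd_pi0 bd_Q0_0; ring. Qed.

Lemma lu_DS n : D n.+1 = D n + (1 - c) * (pi_ n.+1 * Q0 n.+1 ^+ 2).
Proof. by rewrite /lu_D big_nat_recr //=; ring. Qed.

Lemma lu_s_gt0 n : (0 < s n) = (0 < D n).
Proof. by rewrite /lu_s pmulr_lgt0 // invr_gt0 mulr_gt0 ?bd_pi_gt0 ?bd_Q0_gt0. Qed.

Hypothesis s_neq0 : forall n, s n != 0.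

Lemma lu_D_neq0 n : D n != 0.
Proof. by have := s_neq0 n; rewrite mulf_eq0 negb_or => /andP[]. Qed.

(** Off the diagonal the products are immediate; on the diagonal, D cancels
    and what remains is the three-term recurrence of Q at 0. *)
Lemma LU_factorization :
  smul (lu_L lam mu hmu0) (lu_U lam mu hmu0) =2 bd_matrix lam mu.
Proof.
move=> i j; rewrite smul_lower_upper /bd_matrix /lu_s /lu_y /lu_r /lu_x.
have lamN k : lam k != 0 by rewrite gt_eqF.
have muN k : mu k.+1 != 0 by rewrite gt_eqF.
have piN k : pi_ k != 0 by rewrite gt_eqF ?bd_pi_gt0.
have qN k : Q0 k != 0 by rewrite gt_eqF ?bd_Q0_gt0.
case: ifP => [_|_].
  case: i => [|m].
    rewrite -bd_Q0_1 lu_D0 bd_pi0 bd_Q0_0; field; done.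
  (* The diagonal entry of A in the shape that the product produces. *)
  have -> : lam m.+1 + mu m.+1 =
      (lam m.+1 * Q0 m.+2 + mu m.+1 * Q0 m) / Q0 m.+1.
    by rewrite bd_Q0_SS; field.
  rewrite bd_piS /=; field; by rewrite ?lamN ?muN ?piN ?qN ?lu_D_neq0.
case: ifP => [_|_]; first by field; rewrite ?piN ?qN ?lu_D_neq0.
case: ifP => // /eqP ->; rewrite bd_piS /=.
by field; rewrite ?lamN ?muN ?piN ?qN ?lu_D_neq0.
Qed.

(** The off-diagonal entries of the product are the announced rates by
    cancellation. On the diagonal, the two rates are rewritten over the common
    denominator D_n, where the terms in 1 - c cancel. In row 0 the death rate
    is hmu0 = c (lam_0 + mu_0) = c lam_0 q_1, where c plays the part of the
    quotient D_(n-1) / D_n of the other rows. *)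
Lemma darboux_bd_matrix :
  darboux lam mu hmu0 =2
  bd_matrix (darboux_lam lam mu hmu0) (darboux_mu lam mu hmu0).
Proof.
move=> i j; rewrite /darboux smul_upper_lower /bd_matrix.
have lamN k : lam k != 0 by rewrite gt_eqF.
have muN k : mu k.+1 != 0 by rewrite gt_eqF.
have piN k : pi_ k != 0 by rewrite gt_eqF ?bd_pi_gt0.
have qN k : Q0 k != 0 by rewrite gt_eqF ?bd_Q0_gt0.
have dN := lu_D_neq0.
case: ifP => [_|_].
  rewrite /darboux_lam /lu_s /lu_y /lu_r /lu_x.
  case: i => [|m] /=.
    have s0N : lam 0%N + mu 0%N != 0 by rewrite -bd_Q0_1 mulf_neq0.
    have hmu0E : hmu0 = c * (lam 0%N * Q0 1%N).
      by rewrite bd_Q0_1 /lu_c divfK.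
    rewrite lu_DS !bd_piS lu_D0 bd_pi0 bd_Q0_0.
    (* c must become a variable: its body mentions hmu0. *)
    move: (c) hmu0E => c' ->.
    by field; rewrite ?lamN ?muN ?piN ?qN.
  have D_pred : D m = D m.+1 - (1 - c) * (pi_ m.+1 * Q0 m.+1 ^+ 2).
    by rewrite lu_DS; ring.
  rewrite /lu_q /lu_s (lu_DS m.+1) D_pred !bd_piS.
  by field; rewrite ?lamN ?muN ?piN ?qN ?dN.
case: ifP => [_|_].
  rewrite /darboux_lam /lu_s /lu_x; field.
  by rewrite ?lamN ?muN ?piN ?qN ?dN.
case: ifP => // /eqP ->; rewrite /darboux_mu /lu_y /lu_r /lu_q /lu_s bd_piS /=.
by field; rewrite ?lamN ?muN ?piN ?qN ?dN.
Qed.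

(** Positivity of the birth rates propagates D_n > 0 from D_0 = 1; conversely,
    if all D_n are positive then so are all s_n, and the signs of the two factors lu_q in the
    death rates cancel. *)
Lemma darboux_generatorE : 0 <= hmu0 ->
  bd_generator (darboux lam mu hmu0)
    (darboux_lam lam mu hmu0) (darboux_mu lam mu hmu0) <->
  forall n, 0 < D n.
Proof.
move=> hmu0_ge0; split=> [[hlam_gt0 _ _ _]|D_gt0].
  elim=> [|n D_gt0]; first by rewrite lu_D0.
  have := hlam_gt0 n; rewrite /darboux_lam pmulr_rgt0 // pmulr_lgt0.
    by rewrite lu_s_gt0.
  by rewrite invr_gt0 lu_s_gt0.
have s_gt0 n : 0 < s n by rewrite lu_s_gt0.
split=> //; last exact: darboux_bd_matrix.
- by move=> n; apply: mulr_gt0 => //; apply: divr_gt0.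
- move=> n /=; rewrite /lu_q invrN mulrNN.
  have Q0_gt0 := bd_Q0_gt0.
  apply: mulr_gt0; last exact: divr_gt0.
  by apply: mulr_gt0; do ?[apply: divr_gt0 => //]; apply: mulr_gt0.
Qed.

End DarbouxTransform.

Theorem theorem3p4 (R : realType) (A : nat -> nat -> R) (lam mu : nat -> R)
  (hA : bd_generator A lam mu)
  (hmu0 : R) (hmu0_ge0 : 0 <= hmu0)
  (s_neq0 : forall n : nat, lu_s lam mu hmu0 n != 0) :
  [/\ A =2 smul (lu_L lam mu hmu0) (lu_U lam mu hmu0),
      (1 < bd_S lam mu)%E
    & bd_generator (darboux lam mu hmu0)
        (darboux_lam lam mu hmu0) (darboux_mu lam mu hmu0)
      <->
      (0 <= hmu0 <= (lam 0%N + mu 0%N) * ratio_pred (bd_S lam mu))].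
Proof.
case: hA => lam_gt0 mu_gt0 mu0_ge0 AE.
pose w k := bd_pi lam mu k * (bd_Q lam mu k).[0] ^+ 2.
have w_gt0 k : 0 < w k by rewrite mulr_gt0 ?exprn_gt0 ?bd_pi_gt0 ?bd_Q0_gt0.
have w0 : w 0%N = 1 by rewrite /w bd_pi0 bd_Q0_0 expr1n mulr1.
split.
- by move=> i j; rewrite AE LU_factorization.
- exact: series_gt1 w_gt0 w0.
- rewrite darboux_generatorE // hmu0_ge0 /= -ler_pdivrMl ?ltr_wpDr //.
  by rewrite mulrC; exact: (affine_partial_sums_gt0 w_gt0 w0).
Qed.
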